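(* Let $\alpha>0$, $p=1/\sqrt{1+\alpha^2}$, $r(\mathbf y)=\sqrt{\alpha^2+(1-|\mathbf y|)^2}$ for $\mathbf y\in\mathbb{R}^n$, and let $f\in L^2_c(D)$, where $D$ is the open unit ball in $\mathbb{R}^n$. Let $Rf$ be the spherical Radon transform of $f$ with radius function $r$, regarded as a function of $(\lambda,\Theta)$, where $\mathbf y=t\Theta$, $\Theta\in S^{n-1}$, $\lambda=\sqrt{1+\alpha^2}/(2t)$. Let $\mathcal R^{-1}$ be the left inverse of the equidistant sphere transform $\mathcal R$ with parameter $p$. Then $$f(\mathbf x)=\mathcal R^{-1}\left(p^{n-1}Rf\right)(p\mathbf x).$$
   Context: $L^2_c(D)$ is the space of $L^2$ functions with compact support in $D$. $Rf(\mathbf y)=\int_{S(\mathbf y)}f\,dS$, $S(\mathbf y)=\{\mathbf x\in\mathbb{R}^n:|\mathbf x-\mathbf y|=r(\mathbf y)\}$, $dS$ surface measure. In the coordinates $(\lambda,\Theta)$, the sphere with center $t\Theta$ is $|\mathbf x-t\Theta|^2=\alpha^2+(1-t)^2$, and $Rf(\lambda,\Theta)$ is the integral of $f$ over this sphere. The equidistant sphere transform is $$\mathcal Rg(\lambda,\Theta)=\int_{\mathbb{R}^n}|\nabla_{\mathbf y}\Psi_2|\,\delta\left(\lambda-\Psi_2(\mathbf y,\Theta)\right)g(\mathbf y)\,d\mathbf y,\qquad \Psi_2(\mathbf y,\Theta)=\frac{p-\mathbf y\cdot\Theta}{1-|\mathbf y|^2},$$ where $\delta$ is the Dirac delta; i.e.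 the integral of $g$, with respect to surface measure, over the sphere $\{\mathbf y:\Psi_2(\mathbf y,\Theta)=\lambda\}$. $\mathcal R^{-1}$ denotes a left inverse of $\mathcal R$ for functions supported in $D$ (i.e. $\mathcal R^{-1}\mathcal Rg=g$ for such $g$), which is known to exist for $0\le p<1$ by an explicit filtered backprojection formula of Palamodov. *)

(* Defs.v *)
From HB Require Import structures.
From mathcomp Require Import all_boot all_order all_algebra.
From mathcomp Require Import all_classical all_reals all_analysis.

Set Implicit Arguments.
Unset Strict Implicit.
Unset Printing Implicit Defensive.

Import Order.TTheory GRing.Theory Num.Theory.
Import numFieldNormedType.Exports.

Local Open Scope classical_set_scope.
Local Open Scope ring_scope.

Section euclidean.
Context {R : realType} {n : nat}.
Implicit Types x y : 'rV[R]_n.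

(* The library's norm on ['rV[R]_n] is the sup norm. *)
Definition dot x y : R := \sum_(i < n) x ord0 i * y ord0 i.
Definition enorm x : R := Num.sqrt (dot x x).
Definition unit_ball : set 'rV[R]_n := [set x | enorm x < 1].
Definition ediam (A : set 'rV[R]_n) : \bar R :=
  ereal_sup [set (enorm (z.1 - z.2))%:E | z in A `*` A].
End euclidean.

Definition unit_sphere (R : realType) (n : nat) :=
  {Theta : 'rV[R]_n | enorm Theta == 1}.

(* Caratheodory's construction (Method I): the outer measure generated by a
   gauge. The gauge is +oo on the sets that are not allowed in the covers. *)
Section cover_measure.
Local Open Scope ereal_scope.
Context {R : realType} {T : pointedType}.
Variable w : set T -> \bar R.

Definition cover_measure (A : set T) : \bar R :=
  ereal_inf [set \sum_(k <oo) w (F k) |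
              F in [set F : (set T)^nat | A `<=` \bigcup_k F k]].

Hypotheses (w0 : w set0 = 0) (w_ge0 : forall A, 0 <= w A).

Lemma cover_measureE (A : set T) :
  cover_measure A = @mu_ext _ (g_sigma_algebraType [set: set T]) R w A.
Proof.
rewrite /cover_measure /mu_ext; congr ereal_inf; apply/seteqP.
split=> _ [F AF <-]; exists F => //; last by case: AF.
by split=> // k; exact: sub_sigma_algebra.
Qed.

Lemma cover_measure0 : cover_measure set0 = 0.
Proof. by rewrite cover_measureE mu_ext0. Qed.

Lemma cover_measure_ge0 A : 0 <= cover_measure A.
Proof. by rewrite cover_measureE mu_ext_ge0. Qed.

Lemma le_cover_measure : {homo cover_measure : A B / A `<=` B >-> A <= B}.
Proof. by move=> A B AB; rewrite !cover_measureE le_mu_ext. Qed.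

Lemma cover_measure_sigma_subadditive : sigma_subadditive cover_measure.
Proof.
move=> A; rewrite cover_measureE.
under eq_eseriesr do rewrite cover_measureE.
exact: mu_ext_sigma_subadditive.
Qed.
End cover_measure.

Section lebesgue_rV.
Local Open Scope ereal_scope.
Context {R : realType} (n : nat).
Implicit Types A : set 'rV[R]_n.

(* Volume of the smallest closed box containing [A] (+oo if there is none);
   the empty set is singled out for the sake of [n = 0]. *)
Definition box_volume A : \bar R :=
  if A == set0 then 0 else
  ereal_inf [set (\prod_(i < n) (z.2 ord0 i - z.1 ord0 i))%:E |
    z in [set z : 'rV[R]_n * 'rV[R]_n | A `<=`
      [set x | forall i, (z.1 ord0 i <= x ord0 i <= z.2 ord0 i)%R]]].

Definition lebesgue_outer : set 'rV[R]_n -> \bar R :=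
  cover_measure box_volume.

Lemma box_volume0 : box_volume set0 = 0.
Proof. by rewrite /box_volume eqxx. Qed.

Lemma box_volume_ge0 A : 0 <= box_volume A.
Proof.
rewrite /box_volume; case: ifPn => // /set0P[x Ax].
apply: le_ereal_inf_tmp => _ [z /= Az <-]; rewrite lee_fin.
apply: prodr_ge0 => i _; rewrite subr_ge0.
by have /(_ i)/andP[/le_trans] := Az _ Ax; apply.
Qed.

HB.instance Definition _ := isOuterMeasure.Build R 'rV[R]_n lebesgue_outer
  (cover_measure0 box_volume0 box_volume_ge0)
  (cover_measure_ge0 box_volume_ge0)
  (@le_cover_measure _ _ box_volume)
  (cover_measure_sigma_subadditive box_volume_ge0).

Definition lebesgue_outer_measure : {outer_measure set 'rV[R]_n -> \bar R} :=
  lebesgue_outer.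

Definition lebesgue_rV :
    {measure set (caratheodory_type lebesgue_outer_measure) -> \bar R} :=
  lebesgue_outer_measure : set (caratheodory_type lebesgue_outer_measure) -> \bar R.
End lebesgue_rV.

(* The [m]-dimensional Hausdorff measure, normalized so that it is the surface
   measure on [m]-dimensional submanifolds: a set of diameter [d] is gauged by
   the Lebesgue volume of an [m]-dimensional ball of diameter [d]. *)
Section hausdorff.
Local Open Scope ereal_scope.
Context {R : realType} (n m : nat).
Implicit Types A : set 'rV[R]_n.

Definition hausdorff_gauge (delta : R) A : \bar R :=
  if A == set0 then 0 else
  if ediam A <= delta%:E then
    lebesgue_outer [set x : 'rV[R]_m | (enorm x <= 2^-1)%R] * ediam A ^+ m
  else +oo.

Definition hausdorff_outer A : \bar R :=
  ereal_sup [set cover_measure (hausdorff_gauge delta) A |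
              delta in [set delta : R | (0 < delta)%R]].

Lemma hausdorff_gauge0 delta : hausdorff_gauge delta set0 = 0.
Proof. by rewrite /hausdorff_gauge eqxx. Qed.

Lemma hausdorff_gauge_ge0 delta A : 0 <= hausdorff_gauge delta A.
Proof.
rewrite /hausdorff_gauge; case: ifPn => // /set0P[x Ax].
case: ifPn => // _; apply: mule_ge0; first exact: outer_measure_ge0.
apply: expe_ge0; apply: ereal_sup_ubound; exists (x, x) => //=.
rewrite subrr /enorm /dot big1 ?sqrtr0// => i _.
by rewrite mxE mul0r.
Qed.

Lemma hausdorff_outer0 : hausdorff_outer set0 = 0.
Proof.
rewrite /hausdorff_outer; apply/eqP; rewrite eq_le; apply/andP; split.
  apply: ge_ereal_sup => _ [d _ <-].
  by rewrite cover_measure0//;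
    [exact: hausdorff_gauge0|exact: hausdorff_gauge_ge0].
apply: ereal_sup_ubound; exists 1%R => //=.
by rewrite cover_measure0//;
  [exact: hausdorff_gauge0|exact: hausdorff_gauge_ge0].
Qed.

Lemma hausdorff_outer_ge0 A : 0 <= hausdorff_outer A.
Proof.
apply: (@le_trans _ _ (cover_measure (hausdorff_gauge 1) A)).
  exact: cover_measure_ge0 (hausdorff_gauge_ge0 _) _.
by apply: ereal_sup_ubound; exists 1%R => /=.
Qed.

Lemma le_hausdorff_outer : {homo hausdorff_outer : A B / A `<=` B >-> A <= B}.
Proof.
move=> A B AB; apply: ge_ereal_sup => _ [d d0 <-].
apply: le_trans (le_cover_measure _ AB) _.
by apply: ereal_sup_ubound; exists d.
Qed.

Lemma hausdorff_outer_sigma_subadditive : sigma_subadditive hausdorff_outer.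
Proof.
move=> A; apply: ge_ereal_sup => _ [d d0 <-].
have w_ge0 := hausdorff_gauge_ge0 d.
apply: le_trans (cover_measure_sigma_subadditive w_ge0 A) _.
apply: lee_nneseries => [k _ _|k _]; first exact: cover_measure_ge0.
by apply: ereal_sup_ubound; exists d.
Qed.

HB.instance Definition _ := isOuterMeasure.Build R 'rV[R]_n hausdorff_outer
  hausdorff_outer0 hausdorff_outer_ge0 le_hausdorff_outer
  hausdorff_outer_sigma_subadditive.

Definition hausdorff_outer_measure : {outer_measure set 'rV[R]_n -> \bar R} :=
  hausdorff_outer.

Definition hausdorff :
    {measure set (caratheodory_type hausdorff_outer_measure) -> \bar R} :=
  hausdorff_outer_measure : set (caratheodory_type hausdorff_outer_measure) -> \bar R.
End hausdorff.

Section transforms.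
Context {R : realType} {n : nat}.
Local Notation E := 'rV[R]_n.

Definition surface_integral (f : E -> R) (S : set E) : R :=
  \int[hausdorff n n.-1]_(x in S) f x.

(* A class in L^2_c(D) is represented by a function defined on the whole space
   and vanishing everywhere outside a compact subset of [D]. *)
Definition L2c (D : set E) (f : E -> R) : Prop :=
  (f : caratheodory_type (@lebesgue_outer_measure R n) -> R)
    \in Lfun (lebesgue_rV n) 2%:E /\
  exists K : set E, [/\ compact K, K `<=` D & forall x, ~ K x -> f x = 0].

Definition spherical_radon (r : E -> R) (f : E -> R) (y : E) : R :=
  surface_integral f [set x | enorm (x - y) = r y].

Definition radius (alpha : R) (y : E) : R :=
  Num.sqrt (alpha ^+ 2 + (1 - enorm y) ^+ 2).

(* [spherical_radon (radius alpha) f] in the coordinates (lambda, Theta), where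
   the center is [t *: Theta] with [lambda = Num.sqrt (1 + alpha ^+ 2) / (2 t)].
   The centers with [t > 0] correspond to [lambda > 0]; the data are extended by
   0 to [lambda <= 0], in accordance with the fact that the sphere
   |x - t Theta|^2 = alpha^2 + (1 - t)^2 does not meet the unit ball for
   [t < 0]. *)
Definition spherical_radon_coord (alpha : R) (f : E -> R)
    (lambda : R) (Theta : unit_sphere R n) : R :=
  if 0 < lambda then
    spherical_radon (radius alpha) f
      ((Num.sqrt (1 + alpha ^+ 2) / (2 * lambda)) *: val Theta)
  else 0.

Definition Psi2 (p : R) (y Theta : E) : R :=
  (p - dot y Theta) / (1 - enorm y ^+ 2).

(* [Psi2] is not defined on the unit sphere, where division by 0 gives 0. *)
Definition equidistant_transform (p : R) (g : E -> R)
    (lambda : R) (Theta : unit_sphere R n) : R :=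
  surface_integral g
    [set y | enorm y != 1 /\ Psi2 p y (val Theta) = lambda].

Definition is_left_inverse (p : R)
    (Rinv : (R -> unit_sphere R n -> R) -> E -> R) : Prop :=
  forall g : E -> R, L2c unit_ball g ->
    {ae lebesgue_rV n, forall y : E,
      unit_ball y -> Rinv (equidistant_transform p g) y = g y}.
End transforms.

(* Main.v *)
(* Put g(y) = f(y / p). When lambda = 1 / (2 t p), the level set
   {Psi2 = lambda} is the image of |x - t Theta|^2 = alpha^2 + (1 - t)^2 under
   the scaling x |-> p x, up to points of the unit sphere, where g vanishes;
   when lambda <= 0, it misses the support of g.
   Since the (n-1)-dimensional Hausdorff measure is homogeneous of degree n - 1
   under scaling, the equidistant sphere transform of g is exactly p^(n-1) R f.
   A left inverse thus returns g at almost every y, and scalings preserve null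
   sets, so it returns f(x) at y = p x for almost every x. *)
From HB Require Import structures.
Require Import Defs.
From mathcomp Require Import all_boot all_order all_algebra.
From mathcomp Require Import all_classical all_reals all_analysis.
From mathcomp Require Import ring lra.
Import Order.TTheory GRing.Theory Num.Theory.
Import numFieldNormedType.Exports.
Local Open Scope classical_set_scope.
Local Open Scope ring_scope.

(** * Positive factors in the extended reals *)

(** This covers [+oo - +oo] too, so a positive constant comes out of the integral of a signed
    function without integrability. *)
Lemma gt0_muleBr {R : realType} (c : R) (x y : \bar R) : (0 < c)%R ->
  (c%:E * (x - y) = c%:E * x - c%:E * y)%E.
Proof.
move=> c0; case: x y => [x||] [y||]; rewrite ?gt0_muley ?gt0_muleNy ?lte_fin//=.
by rewrite -EFinB -!EFinM -EFinB mulrBr.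
Qed.

Lemma fine_mulEFin {R : realType} (c : R) (x : \bar R) : (0 < c)%R ->
  (fine (c%:E * x) = c * fine x)%R.
Proof.
move=> c0; case: x => [x||]; rewrite ?gt0_muley ?gt0_muleNy ?lte_fin//= mulr0//.
Qed.

Import HBNNSimple.

(** * Change of variables under maps that multiply a measure by a constant *)

Section change_of_variables.
Local Open Scope ereal_scope.
Context {d1 d2 : measure_display} {T1 : measurableType d1}
  {T2 : measurableType d2} {R : realType}.

(** A simple function [h] below [f] pulls back to the simple function [h \o phi] below [f \o phi],
    whose integral is [c] times that of [h]. *)
Lemma ge0_integral_comp_ge (mu1 : {measure set T1 -> \bar R})
    (mu2 : {measure set T2 -> \bar R}) (phi : T1 -> T2) (c : R)
    (f : T2 -> \bar R) : (0 < c)%R -> measurable_fun setT phi ->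
  (forall A, measurable A -> mu1 (phi @^-1` A) = c%:E * mu2 A) ->
  (forall x, 0 <= f x) ->
  c%:E * \int[mu2]_x f x <= \int[mu1]_x f (phi x).
Proof.
move=> c0 mphi muphi f0.
rewrite !ge0_integralTE// -ereal_sup_pZl//.
apply: ge_ereal_sup => _ [_ [h /= hf <-] <-].
pose k := h \o phi.
have mk : measurable_fun setT k by exact: measurableT_comp.
have fk : finite_set (range k).
  by apply: sub_finite_set (fimfunP h) => _ [x _ <-]; exists (phi x).
have k0 x : (0 <= k x)%R by exact: fun_ge0.
pose k1 := isMeasurableFun.Build _ _ _ _ k mk.
pose k2 := FiniteImage.Build _ _ k fk.
pose k3 := isNonNegFun.Build _ _ k k0.
pose kS : {nnsfun T1 >-> R} := HB.pack k k1 k2 k3.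
apply: ereal_sup_ubound; exists kS => [x|]; first exact: hf.
rewrite !sintegralET ge0_mule_fsumr; last exact: nnsfun_mulemu_ge0.
apply: eq_fsbigr => r _; rewrite muleCA -muphi//.
Qed.
End change_of_variables.

Section change_of_variables_bijective.
Local Open Scope ereal_scope.
Context {d1 d2 : measure_display} {T1 : measurableType d1}
  {T2 : measurableType d2} {R : realType}.

(** The missing inequality is the previous one for [psi], the constant [c^-1] and the integrand
    [f \o phi]. *)
Lemma ge0_integral_comp_bij (mu1 : {measure set T1 -> \bar R})
    (mu2 : {measure set T2 -> \bar R}) (phi : T1 -> T2) (psi : T2 -> T1)
    (c : R) (f : T2 -> \bar R) :
  cancel phi psi -> cancel psi phi -> (0 < c)%R ->
  measurable_fun setT phi -> measurable_fun setT psi ->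
  (forall A, measurable A -> mu1 (phi @^-1` A) = c%:E * mu2 A) ->
  (forall x, 0 <= f x) ->
  \int[mu1]_x f (phi x) = c%:E * \int[mu2]_x f x.
Proof.
move=> phiK psiK c0 mphi mpsi muphi f0; apply/eqP; rewrite eq_le andbC.
rewrite ge0_integral_comp_ge//= -lee_pdivrMl//.
rewrite [leRHS](_ : _ = \int[mu2]_x (f \o phi) (psi x)); last first.
  by apply: eq_integral => y _ /=; rewrite psiK.
apply: (ge0_integral_comp_ge mu2 mu1 psi c^-1%R (f \o phi))
  => [|//|B mB|x]; rewrite ?invr_gt0//; last exact: f0.
have phi_psi : phi @^-1` (psi @^-1` B) = B.
  by apply/seteqP; split => x /=; rewrite phiK.
rewrite -[in RHS]phi_psi muphi; last by rewrite -[_ @^-1` _]setTI; exact: mpsi.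
by rewrite muleA -EFinM mulVf ?gt_eqF// mul1e.
Qed.

(* [f] need not be measurable: [integral] is a supremum over simple functions,
   and these correspond to each other under [phi]. *)
Lemma integral_comp_bij (mu1 : {measure set T1 -> \bar R})
    (mu2 : {measure set T2 -> \bar R}) (phi : T1 -> T2) (psi : T2 -> T1)
    (c : R) (D : set T2) (f : T2 -> \bar R) :
  cancel phi psi -> cancel psi phi -> (0 < c)%R ->
  measurable_fun setT phi -> measurable_fun setT psi ->
  (forall A, measurable A -> mu1 (phi @^-1` A) = c%:E * mu2 A) ->
  \int[mu1]_(x in phi @^-1` D) f (phi x) = c%:E * \int[mu2]_(x in D) f x.
Proof.
move=> phiK psiK c0 mphi mpsi muphi.
have phiD x : ((f \o phi) \_ (phi @^-1` D)) x = (f \_ D) (phi x).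
  by rewrite /patch /=.
rewrite integral_mkcond [in RHS]integral_mkcond integralE [in RHS]integralE.
rewrite gt0_muleBr// -!(ge0_integral_comp_bij mu1 mu2 phi psi c)//.
by congr (_ - _); apply: eq_integral => x _;
  rewrite ?(funeposE, funenegE) phiD.
Qed.
End change_of_variables_bijective.

Section caratheodory_preimage.
Local Open Scope ereal_scope.
Context {R : realType} {T1 T2 : pointedType}.

(** Every test set [X] is the preimage under [phi] of [psi @^-1] X[, so cutting]X[by]phi @^-1[A] is,
    up to the factor [c], cutting that set by [A]. *)
Lemma caratheodory_measurable_preimage
    (mu1 : {outer_measure set T1 -> \bar R})
    (mu2 : {outer_measure set T2 -> \bar R}) (phi : T1 -> T2) (psi : T2 -> T1)
    (c : R) :
  cancel phi psi -> cancel psi phi -> (0 < c)%R ->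
  (forall A, mu1 (phi @^-1` A) = c%:E * mu2 A) ->
  forall A, mu2.-caratheodory A -> mu1.-caratheodory (phi @^-1` A).
Proof.
move=> phiK psiK c0 muphi A mA; apply: le_caratheodory_measurable => X.
have E Y : phi @^-1` (psi @^-1` Y) = Y.
  by apply/seteqP; split => x /=; rewrite phiK.
rewrite -[X]E preimage_setC -!preimage_setI !muphi -ge0_muleDr//.
by rewrite -mA.
Qed.
End caratheodory_preimage.

(** * Homogeneity of the Lebesgue and Hausdorff outer measures *)

Section scaling.
Local Open Scope ereal_scope.
Context {R : realType}.

(** Preimages of the members of a cover of [A] cover the preimage of [A], so a bound on gauges
    passes to the outer measures. *)
Lemma le_cover_measure_preimage (T1 T2 : pointedType) (w1 : set T1 -> \bar R)
    (w2 : set T2 -> \bar R) (phi : T1 -> T2) (c : R) : (0 < c)%R ->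
  (forall A, 0 <= w1 A) -> (forall A, 0 <= w2 A) ->
  (forall A, w1 (phi @^-1` A) <= c%:E * w2 A) ->
  forall A, cover_measure w1 (phi @^-1` A) <= c%:E * cover_measure w2 A.
Proof.
move=> c0 w1_ge0 w2_ge0 w12 A; rewrite -ereal_inf_pZl//.
apply: le_ereal_inf_tmp => _ [_ [F AF <-] <-].
rewrite -nneseriesZl//.
apply: (@le_trans _ _ (\sum_(k <oo) w1 (phi @^-1` F k))).
  apply: ereal_inf_lbound; exists (fun k => phi @^-1` F k) => //.
  by move=> x /AF [k _ Fk]; exists k.
exact: lee_nneseries.
Qed.

Lemma lee_expe_scale (c : R) (x y : \bar R) (m : nat) :
  0 <= x -> x <= c%:E * y -> x ^+ m <= (c ^+ m)%:E * y ^+ m.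
Proof.
move=> x0 xy; elim: m => [|m IH]; first by rewrite !expe0 expr0 mul1e.
rewrite !expeS exprS EFinM muleACA; apply: lee_pmul => //.
exact: expe_ge0.
Qed.

Context {n : nat}.
Implicit Types (a : R) (A : set 'rV[R]_n).

Lemma enormZ a (x : 'rV[R]_n) : enorm (a *: x) = (`|a| * enorm x)%R.
Proof.
rewrite /enorm /dot -sqrtr_sqr -sqrtrM ?sqr_ge0// mulr_sumr.
by congr Num.sqrt; apply: eq_bigr => i _; rewrite !mxE; ring.
Qed.

Lemma ediam_ge0 A : A !=set0 -> 0 <= ediam A.
Proof.
move=> [x Ax]; apply: ereal_sup_ubound; exists (x, x) => //=.
by rewrite subrr -[0%R](scale0r 0%R) enormZ normr0 mul0r.
Qed.

Lemma le_ediam_preimage_scale a A : (0 < a)%R ->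
  ediam ( *:%R a @^-1` A) <= a^-1%:E * ediam A.
Proof.
move=> a0; apply: ge_ereal_sup => _ [[x y] [/= Ax Ay] <-].
rewrite lee_pdivlMl// -EFinM -{1}(gtr0_norm a0) -enormZ scalerBr.
by apply: ereal_sup_ubound; exists (a *: x, a *: y).
Qed.

Lemma le_box_volume_preimage_scale a A : (0 < a)%R ->
  box_volume ( *:%R a @^-1` A) <= (a ^- n)%:E * box_volume A.
Proof.
move=> a0; have an0 : (0 < a ^- n)%R by rewrite invr_gt0 exprn_gt0.
rewrite [box_volume (_ @^-1` _)]/box_volume; case: ifPn => [_|/set0P[x0 Ax0]].
  by rewrite mule_ge0 ?box_volume_ge0// lee_fin ltW.
rewrite /box_volume ifF; last by apply/negbTE/set0P; exists (a *: x0).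
rewrite -ereal_inf_pZl//; apply: le_ereal_inf_tmp => _ [_ [z /= Az <-] <-].
(* Shrinking both corners of the box multiplies each of its [n] sides by [a^-1]. *)
apply: ereal_inf_lbound; exists (a^-1 *: z.1, a^-1 *: z.2)%R => /=.
  move=> x /= /Az /= + i => /(_ i); rewrite !mxE => /andP[zx xz].
  by rewrite ler_pdivrMl// zx ler_pdivlMl.
rewrite -EFinM -exprVn -[X in (_ ^+ X)%R](card_ord n) -prodr_const.
by rewrite -big_split/=; congr EFin; apply: eq_bigr => i _; rewrite !mxE mulrBr.
Qed.

(** The mesh changes with the set: diameter at most [a * delta] becomes at most [delta] in the
    preimage. Larger sets have gauge [+oo] on the right. *)
Lemma le_hausdorff_gauge_preimage_scale m a delta A : (0 < a)%R ->
  hausdorff_gauge m delta ( *:%R a @^-1` A) <=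
  (a ^- m)%:E * hausdorff_gauge m (a * delta) A.
Proof.
move=> a0; have am0 : (0 < a ^- m)%R by rewrite invr_gt0 exprn_gt0.
rewrite [hausdorff_gauge m delta _]/hausdorff_gauge.
case: ifPn => [_|/set0P[x0 Ax0]].
  by rewrite mule_ge0 ?hausdorff_gauge_ge0// lee_fin ltW.
rewrite /hausdorff_gauge [A == set0]negbTE; last first.
  by apply/set0P; exists (a *: x0).
have [Ad|_] := leP (ediam A) (a * delta)%:E; last first.
  by rewrite gt0_muley ?lte_fin// leey.
rewrite ifT; last first.
  apply: le_trans (le_ediam_preimage_scale _ _ a0) _.
  by rewrite lee_pdivrMl.
rewrite muleCA; apply: lee_wpmul2l; first exact: outer_measure_ge0.
rewrite -exprVn; apply: lee_expe_scale; last exact: le_ediam_preimage_scale.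
by apply: ediam_ge0; exists x0.
Qed.

Lemma le_lebesgue_outer_preimage_scale a A : (0 < a)%R ->
  lebesgue_outer ( *:%R a @^-1` A) <= (a ^- n)%:E * lebesgue_outer A.
Proof.
move=> a0; apply: le_cover_measure_preimage => [||B|B].
- by rewrite invr_gt0 exprn_gt0.
- exact: box_volume_ge0.
- exact: box_volume_ge0.
- exact: le_box_volume_preimage_scale.
Qed.

Lemma le_hausdorff_outer_preimage_scale m a A : (0 < a)%R ->
  hausdorff_outer m ( *:%R a @^-1` A) <= (a ^- m)%:E * hausdorff_outer m A.
Proof.
move=> a0; have am0 : (0 < a ^- m)%R by rewrite invr_gt0 exprn_gt0.
apply: ge_ereal_sup => _ [delta /= d0 <-].
(* The mesh [a * delta] is again positive, hence admissible in the supremum defining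
   [hausdorff_outer]. *)
apply: (@le_trans _ _
    ((a ^- m)%:E * cover_measure (hausdorff_gauge m (a * delta)) A)).
  apply: le_cover_measure_preimage => // B.
  - exact: hausdorff_gauge_ge0.
  - exact: hausdorff_gauge_ge0.
  - exact: le_hausdorff_gauge_preimage_scale.
apply: lee_wpmul2l; first by rewrite lee_fin ltW.
by apply: ereal_sup_ubound; exists (a * delta)%R => //=; rewrite mulr_gt0.
Qed.

(* The reverse inequality is the inequality for the inverse scaling. *)
Lemma preimage_scale_eq m (mu : set 'rV[R]_n -> \bar R) :
  (forall a A, (0 < a)%R -> mu ( *:%R a @^-1` A) <= (a ^- m)%:E * mu A) ->
  forall a A, (0 < a)%R -> mu ( *:%R a @^-1` A) = (a ^- m)%:E * mu A.
Proof.
move=> mu_le a A a0; apply/eqP; rewrite eq_le mu_le//=.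
rewrite lee_pdivrMl ?exprn_gt0//.
have := @mu_le a^-1%R ( *:%R a @^-1` A).
rewrite invr_gt0 -exprVn invrK => /(_ a0); congr (mu _ <= _).
apply/seteqP; split => x /=; rewrite scalerA divff ?scale1r ?gt_eqF//.
Qed.

Lemma lebesgue_outer_preimage_scale a A : (0 < a)%R ->
  lebesgue_outer ( *:%R a @^-1` A) = (a ^- n)%:E * lebesgue_outer A.
Proof.
by apply: preimage_scale_eq => {}a {}A; exact: le_lebesgue_outer_preimage_scale.
Qed.

Lemma hausdorff_outer_preimage_scale m a A : (0 < a)%R ->
  hausdorff_outer m ( *:%R a @^-1` A) = (a ^- m)%:E * hausdorff_outer m A.
Proof.
apply: preimage_scale_eq => {}a {}A; exact: le_hausdorff_outer_preimage_scale.
Qed.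
End scaling.

(** * Scaling of integrals, null sets and compactly supported L^2 functions *)

Section scaling_measures.
Local Open Scope ereal_scope.
Context {R : realType} {n : nat}.
Implicit Types (a : R) (f : 'rV[R]_n -> \bar R) (D : set 'rV[R]_n).

Lemma scale_cancel a : (0 < a)%R ->
  cancel ( *:%R a : 'rV[R]_n -> 'rV[R]_n) ( *:%R a^-1%R).
Proof. by move=> a0; apply: scalerK; rewrite gt_eqF. Qed.

Lemma scaleV_cancel a : (0 < a)%R ->
  cancel ( *:%R a^-1%R : 'rV[R]_n -> 'rV[R]_n) ( *:%R a).
Proof. by move=> a0; apply: scalerKV; rewrite gt_eqF. Qed.

Lemma measurable_scale m (mu : {outer_measure set 'rV[R]_n -> \bar R}) :
  (forall a A, (0 < a)%R -> mu ( *:%R a @^-1` A) = (a ^- m)%:E * mu A) ->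
  forall a, (0 < a)%R -> measurable_fun setT
    ( *:%R a : caratheodory_type mu -> caratheodory_type mu).
Proof.
move=> muS a a0 _ A mA; rewrite setTI.
apply: (caratheodory_measurable_preimage mu mu _ _ (a ^- m)
  (scale_cancel a a0) (scaleV_cancel a a0)) => // [|B].
- by rewrite invr_gt0 exprn_gt0.
- exact: muS.
Qed.

Lemma lebesgue_integral_scale a D f : (0 < a)%R ->
  \int[lebesgue_rV n]_(x in *:%R a @^-1` D) f (a *: x)%R =
  (a ^- n)%:E * \int[lebesgue_rV n]_(x in D) f x.
Proof.
move=> a0; have mS := measurable_scale n (@lebesgue_outer_measure R n)
  lebesgue_outer_preimage_scale.
apply: (integral_comp_bij (lebesgue_rV n) (lebesgue_rV n)
  ( *:%R a) ( *:%R a^-1%R)).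
- exact: scale_cancel.
- exact: scaleV_cancel.
- by rewrite invr_gt0 exprn_gt0.
- exact: mS.
- by apply: mS; rewrite invr_gt0.
- by move=> A _; exact: lebesgue_outer_preimage_scale.
Qed.

Lemma hausdorff_integral_scale m a D f : (0 < a)%R ->
  \int[hausdorff n m]_(x in *:%R a @^-1` D) f (a *: x)%R =
  (a ^- m)%:E * \int[hausdorff n m]_(x in D) f x.
Proof.
move=> a0; have mS := measurable_scale m (@hausdorff_outer_measure R n m)
  (hausdorff_outer_preimage_scale m).
apply: (integral_comp_bij (hausdorff n m) (hausdorff n m)
  ( *:%R a) ( *:%R a^-1%R)).
- exact: scale_cancel.
- exact: scaleV_cancel.
- by rewrite invr_gt0 exprn_gt0.
- exact: mS.
- by apply: mS; rewrite invr_gt0.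
- by move=> A _; exact: hausdorff_outer_preimage_scale.
Qed.

Lemma lebesgue_negligible_scale a D : (0 < a)%R ->
  (lebesgue_rV n).-negligible D ->
  (lebesgue_rV n).-negligible ( *:%R a @^-1` D).
Proof.
move=> a0 [M [mM M0 DM]]; exists ( *:%R a @^-1` M); split.
- have := measurable_scale n (@lebesgue_outer_measure R n)
    lebesgue_outer_preimage_scale a a0 measurableT M mM.
  by rewrite setTI.
- apply: etrans (lebesgue_outer_preimage_scale _ _ a0) _.
  by rewrite [lebesgue_outer M]M0 mule0.
- by move=> x /DM.
Qed.

Lemma L2c_scale a (g : 'rV[R]_n -> R) : (1 <= a)%R -> L2c unit_ball g ->
  L2c unit_ball (fun x => g (a *: x)%R).
Proof.
move=> a1 [gL2 [K [cK KB gK]]]; have a0 : (0 < a)%R := lt_le_trans ltr01 a1.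
split.
  have /andP[] := gL2; rewrite !inE /= => mg.
  rewrite /finite_norm unlock => g2.
  apply/andP; split; rewrite inE/=.
    apply: (measurableT_comp mg).
    exact: (measurable_scale n (@lebesgue_outer_measure R n)
      lebesgue_outer_preimage_scale).
  rewrite /finite_norm unlock; apply: poweR_lty.
  have := lebesgue_integral_scale a setT (fun x => `|(g x)%:E| `^ 2) a0.
  rewrite preimage_setT => ->.
  apply: lte_mul_pinfty => //.
    by rewrite lee_fin invr_ge0 exprn_ge0// ltW.
  (* The L^2 norm is a power of the integral with nonzero exponent, so its finiteness gives that of
     the integral. *)
  by apply: lty_poweRy g2; rewrite invr_neq0.
(* The support shrinks by the factor [a^-1], at most 1, and so stays in the ball. *)
exists ( *:%R a^-1%R @` K); split.
- apply: continuous_compact cK; apply: continuous_subspaceT.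
  exact: scaler_continuous.
- move=> _ [x /KB + <-]; rewrite /unit_ball/= enormZ => x1.
  rewrite gtr0_norm ?invr_gt0// ltr_pdivrMl// mulr1.
  exact: lt_le_trans x1 a1.
- move=> x Kx; apply: gK => Kax; apply: Kx.
  by exists (a *: x)%R => //; rewrite scale_cancel.
Qed.
End scaling_measures.

(** * Level sets of [Psi2] as scaled spheres *)

Section radon.
Context {R : realType} {n : nat}.
Implicit Types (x y Theta : 'rV[R]_n).

Lemma dot_ge0 x : 0 <= dot x x.
Proof. by apply: sumr_ge0 => i _; rewrite -expr2 sqr_ge0. Qed.

Lemma sqr_enorm x : enorm x ^+ 2 = dot x x.
Proof. by rewrite sqr_sqrtr ?dot_ge0. Qed.

Lemma enorm_ge0 x : 0 <= enorm x.
Proof. exact: sqrtr_ge0. Qed.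

Lemma dotZl (a : R) x y : dot (a *: x) y = a * dot x y.
Proof.
by rewrite /dot mulr_sumr; apply: eq_bigr => i _; rewrite mxE mulrA.
Qed.

Lemma sqr_enormB x y (t : R) :
  enorm (x - t *: y) ^+ 2 =
  enorm x ^+ 2 - 2 * t * dot x y + t ^+ 2 * enorm y ^+ 2.
Proof.
rewrite !sqr_enorm /dot !mulr_sumr -sumrB -big_split/=.
by apply: eq_bigr => i _; rewrite !mxE; ring.
Qed.

(* With [y = p x] and [t = 1 / (2 lambda p)], multiplying
   [Psi2 p y Theta = lambda] by [1 - |y|^2] and dividing by [lambda p^2] gives
   [|x|^2 - 2 t x.Theta = 1 / p^2 - 2 t], where [1 / p^2 = 1 + alpha^2]. *)
Lemma Psi2_scaleE (alpha p lambda : R) x Theta :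
  0 < p -> p ^+ 2 * (1 + alpha ^+ 2) = 1 -> 0 < lambda ->
  enorm Theta = 1 -> enorm (p *: x) < 1 ->
  (Psi2 p (p *: x) Theta == lambda) =
  (enorm (x - (2 * lambda * p)^-1 *: Theta) ==
   Defs.radius alpha ((2 * lambda * p)^-1 *: Theta)).
Proof.
move=> p0 palpha l0 T1 x1; set t := (2 * lambda * p)^-1.
have t0 : 0 < t by rewrite invr_gt0 !mulr_gt0.
have lE : lambda = (2 * t * p)^-1.
  by rewrite /t; field; rewrite !gt_eqF.
have xp : 0 < 1 - enorm (p *: x) ^+ 2.
  by rewrite subr_gt0 expr_lt1// enorm_ge0.
rewrite -[RHS](@eqrXn2 _ 2)// ?enorm_ge0 ?sqrtr_ge0//.
rewrite sqr_enormB T1 expr1n mulr1.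
rewrite [Defs.radius _ _ ^+ 2]sqr_sqrtr ?addr_ge0 ?sqr_ge0//.
rewrite enormZ T1 mulr1 gtr0_norm//.
rewrite /Psi2 dotZl; rewrite enormZ gtr0_norm// exprMn in xp *.
have p2 : p ^+ 2 != 0 by rewrite expf_neq0 ?gt_eqF.
have tp2 : 2 * t * p != 0 by rewrite !mulf_neq0// gt_eqF.
have xp_neq0 : 1 - p ^+ 2 * enorm x ^+ 2 != 0 by rewrite gt_eqF.
rewrite (can2_eq (divfK xp_neq0) (mulfK xp_neq0)).
rewrite -[LHS](inj_eq (mulfI tp2)) lE mulVKf// -[RHS](inj_eq (mulfI p2)).
(* The terms in [t ^+ 2] cancel, and [palpha] replaces [p ^+ 2 * (1 + alpha ^+ 2)] by 1. *)
by apply/eqP/eqP => h; lra.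
Qed.

(** This matches the value 0 given to the data for [lambda <= 0]: no level set at such [lambda]
    meets the scaled ball. *)
Lemma Psi2_scale_gt0 (p : R) x Theta :
  0 < p -> p <= 1 -> enorm Theta = 1 -> enorm x < 1 ->
  0 < Psi2 p (p *: x) Theta.
Proof.
move=> p0 p1 T1 x1; have px1 : enorm (p *: x) < 1.
  rewrite enormZ gtr0_norm//; apply: le_lt_trans x1.
  by rewrite ler_piMl ?enorm_ge0.
rewrite /Psi2 divr_gt0//; last by rewrite subr_gt0 expr_lt1// enorm_ge0.
rewrite dotZl -{1}(mulr1 p) -mulrBr mulr_gt0//.
(* Expanding [|x - Theta|^2 >= 0] with [|x| < 1] gives [dot x Theta < 1]. *)
have := sqr_ge0 (enorm (x - 1 *: Theta)); rewrite sqr_enormB T1.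
have : enorm x ^+ 2 < 1 by rewrite expr_lt1// enorm_ge0.
lra.
Qed.

Lemma equidistant_transform_scale (alpha p : R) (f : 'rV[R]_n -> R) :
  0 < p -> p <= 1 -> p ^+ 2 * (1 + alpha ^+ 2) = 1 ->
  (forall x, ~ unit_ball x -> f x = 0) ->
  equidistant_transform p (fun y => f (p^-1 *: y)) =
  (fun lambda (Theta : unit_sphere R n) =>
     p ^+ n.-1 * spherical_radon_coord alpha f lambda Theta).
Proof.
move=> p0 p1 palpha f0.
apply/funext => lambda; apply/funext; case=> Theta TE; have T1 := eqP TE.
have sE : Num.sqrt (1 + alpha ^+ 2) = p^-1.
  rewrite -[RHS]ger0_norm ?invr_ge0 ?ltW// -sqrtr_sqr; congr Num.sqrt.
  apply: (mulfI (_ : p ^+ 2 != 0)); first by rewrite expf_neq0 ?gt_eqF.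
  by rewrite palpha -exprMn divff ?expr1n ?gt_eqF.
(* Since [f] vanishes off the ball, the two surfaces need only correspond there; the factor comes
   from scaling by [p^-1] in dimension [n.-1]. *)
have fE (S1 S2 : set 'rV[R]_n) :
    (forall x, unit_ball x -> (p *: x \in S1) = (x \in S2)) ->
    surface_integral (fun y => f (p^-1 *: y)) S1 =
    p ^+ n.-1 * surface_integral f S2.
  move=> S12; rewrite /surface_integral /Rintegral -fine_mulEFin ?exprn_gt0//.
  congr fine; have p'0 : 0 < p^-1 by rewrite invr_gt0.
  have := hausdorff_integral_scale n.-1 p^-1 S2 (EFin \o f) p'0.
  rewrite exprVn invrK => <-.
  rewrite integral_mkcond [RHS]integral_mkcond; apply: eq_integral => y _.
  rewrite /patch/=.
  have [Bx|/f0 ->] := pselect (unit_ball (p^-1 *: y)); last by rewrite !if_same.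
  by have := S12 _ Bx; rewrite scaleV_cancel => [->|].
rewrite /equidistant_transform /spherical_radon_coord/=.
have pB x : unit_ball x -> enorm (p *: x) < 1.
  move=> x1; rewrite enormZ gtr0_norm//; apply: le_lt_trans x1.
  by rewrite ler_piMl ?enorm_ge0.
case: ifPn => [l0|]; last first.
  rewrite -leNgt => l0; rewrite (fE _ set0) => [|x x1].
    by rewrite /surface_integral Rintegral_set0.
  rewrite in_set0; apply/negbTE; rewrite notin_setE => -[_ /=].
  have := Psi2_scale_gt0 p x Theta p0 p1 T1 x1; move=> + E; rewrite E; lra.
have tE : Num.sqrt (1 + alpha ^+ 2) / (2 * lambda) = (2 * lambda * p)^-1.
  by rewrite sE -invfM mulrC.
rewrite /spherical_radon tE; apply: fE => x Bx.
have := Psi2_scaleE alpha p lambda x Theta p0 palpha l0 T1 (pB x Bx).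
move=> PE; apply/idP/idP; rewrite !inE/=.
  by move=> [_ /eqP]; rewrite PE => /eqP.
(* The condition [enorm y != 1] is automatic here, as [p *: x] lies inside the ball. *)
by move=> /eqP; rewrite -PE => /eqP ->; rewrite lt_eqF// pB.
Qed.
End radon.

(** * Inversion almost everywhere *)

Theorem corollary4p14 (R : realType) (n : nat) (n_gt0 : (0 < n)%N)
    (alpha p : R) (alpha_gt0 : 0 < alpha)
    (pE : p = 1 / Num.sqrt (1 + alpha ^+ 2))
    (f : 'rV[R]_n -> R) (f_L2c : L2c unit_ball f)
    (Rinv : (R -> unit_sphere R n -> R) -> 'rV[R]_n -> R)
    (RinvP : is_left_inverse p Rinv) :
  {ae lebesgue_rV n, forall x : 'rV[R]_n, unit_ball (p *: x) ->
    f x = Rinv (fun lambda Theta =>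
                  p ^+ n.-1 * spherical_radon_coord alpha f lambda Theta)
               (p *: x)}.
Proof.
have a0 : 0 < 1 + alpha ^+ 2 by rewrite addr_gt0// exprn_gt0.
have p0 : 0 < p by rewrite pE divr_gt0// sqrtr_gt0.
have palpha : p ^+ 2 * (1 + alpha ^+ 2) = 1.
  by rewrite pE div1r exprVn sqr_sqrtr ?ltW// mulVf ?gt_eqF.
have p1 : p <= 1.
  rewrite -(@expr_le1 _ 2 _ _ (ltW p0))// -[leRHS]palpha ler_peMr ?sqr_ge0//.
  by rewrite lerDl sqr_ge0.
have f0 x : ~ unit_ball x -> f x = 0.
  by have [_ [K [_ KB fK]]] := f_L2c => xB; apply: fK => /KB.
rewrite -equidistant_transform_scale//.
have := RinvP _ (L2c_scale p^-1 f _ f_L2c); rewrite invf_ge1// => /(_ p1).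
(* The exceptional set of points [y] is null; pulling it back along [y = p *: x] gives a null set of
   points [x]. *)
move=> /(lebesgue_negligible_scale p _ p0); apply: negligibleS => x /=.
by apply: contra_not => h /h; rewrite scale_cancel.
Qed.
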